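(* (Disjunctive Visser's rules for $\mathsf{iK_{d*}}$) Let $I$ be a finite set (possibly empty), $\{m_i\}_{i \in I}$ be a sequence of natural numbers, let $A_i,B_i$ ($i\in I$), $C$, $D$ be $\mathcal{L}_*$-formulas, and let $$X=\bigwedge_{i \in I} \nabla^{m_i}(A_i \to B_i).$$ If $\mathsf{iK_{d*}} \vdash X \rightarrow (C \vee D)$, then one of the following holds: - $\mathsf{iK_{d*}} \vdash X \rightarrow \nabla^{m_i-1} A_i$, for some $i \in I$ with $m_i \geq 1$; - $\mathsf{iK_{d*}} \vdash X \rightarrow C$; - $\mathsf{iK_{d*}} \vdash X \rightarrow D$.
   Context: Language and sequents. Fix a set $V$ of atomic propositions. $\mathcal{L}_*$-formulas are built from atoms in $V$ and the constants $\top,\bot$ using binary connectives $\wedge,\vee,\to$ and the unary connective $\nabla$. $\nabla^n A$ is the $n$-fold application of $\nabla$ to $A$, and $\nabla\Gamma=\{\nabla A \mid A\in\Gamma\}$ as a multiset. $\bigwedge$ denotes finite iterated conjunction, with the empty conjunction equal to $\top$. Natural numbers include $0$. A sequent over $\mathcal{L}_*$ is an expression $\Gamma\Rightarrow\Delta$ with $\Gamma,\Delta$ finite multisets of $\mathcal{L}_*$-formulas, $\Delta$ containing at most one formula. Comma is multiset union; a formula stands for its singleton. Calculus $\mathbf{STL(N)}$ (over $\mathcal{L}_*$). Rules are written ''premises / conclusion''; $\Gamma,\Sigma$ are arbitrary finite multisets, $\Delta$ has at most one formula, $A,B$ are arbitrary $\mathcal{L}_*$-formulas. Axioms: $(Id)$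 $A\Rightarrow A$; $(L\bot)$ $\bot\Rightarrow$; $(R\top)$ $\Rightarrow\top$. $(Lw)$ $\Gamma\Rightarrow\Delta$ / $\Gamma,A\Rightarrow\Delta$. $(Rw)$ $\Gamma\Rightarrow$ / $\Gamma\Rightarrow A$. $(Lc)$ $\Gamma,A,A\Rightarrow\Delta$ / $\Gamma,A\Rightarrow\Delta$. $(cut)$ $\Gamma\Rightarrow A$ and $\Sigma,A\Rightarrow\Delta$ / $\Sigma,\Gamma\Rightarrow\Delta$. $(L\wedge_1)$ $\Gamma,A\Rightarrow\Delta$ / $\Gamma,A\wedge B\Rightarrow\Delta$. $(L\wedge_2)$ $\Gamma,B\Rightarrow\Delta$ / $\Gamma,A\wedge B\Rightarrow\Delta$. $(R\wedge)$ $\Gamma\Rightarrow A$ and $\Gamma\Rightarrow B$ / $\Gamma\Rightarrow A\wedge B$. $(L\vee)$ $\Gamma,A\Rightarrow\Delta$ and $\Gamma,B\Rightarrow\Delta$ / $\Gamma,A\vee B\Rightarrow\Delta$. $(R\vee_1)$ $\Gamma\Rightarrow A$ / $\Gamma\Rightarrow A\vee B$. $(R\vee_2)$ $\Gamma\Rightarrow B$ / $\Gamma\Rightarrow A\vee B$. $(N)$ $\Gamma\Rightarrow\Delta$ / $\nabla\Gamma\Rightarrow\nabla\Delta$. $(L\to)$ $\Gamma\Rightarrow A$ and $\Gamma,B\Rightarrow\Delta$ / $\Gamma,\nabla(A\to B)\Rightarrow\Delta$. $(R\to)$ $\nabla\Gamma,A\Rightarrow B$ / $\Gamma\Rightarrow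 A\to B$. The logic $\mathsf{iK_{d*}}$ is the set of $\mathcal{L}_*$-formulas $A$ such that $\Rightarrow A$ has a proof-tree in $\mathbf{STL(N)}$; $\mathsf{iK_{d*}}\vdash A$ means $A\in\mathsf{iK_{d*}}$. *)

(* Defs.v *)
From mathcomp Require Import all_boot.
From Stdlib Require Import Permutation.

Set Implicit Arguments.
Unset Strict Implicit.
Unset Printing Implicit Defensive.

Inductive form (V : Type) : Type :=
| Atom of V
| Top
| Bot
| And of form V & form V
| Or of form V & form V
| Imp of form V & form V
| Nabla of form V.

Arguments Top {V}.
Arguments Bot {V}.

Fixpoint bigAnd (V : Type) (s : seq (form V)) : form V :=
  match s with
  | [::] => Top
  | [:: A] => A
  | A :: s' => And A (bigAnd s')
  end.

(* [STLN G D] : the sequent G => D has a proof tree in STL(N).  The finite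
   multiset G is a list up to [Permutation], via the rule [Exch]; the succedent,
   a multiset with at most one formula, is an [option]. *)
Inductive STLN (V : Type) : seq (form V) -> option (form V) -> Prop :=
| Exch G G' D : Permutation G G' -> STLN G D -> STLN G' D
| Id A : STLN [:: A] (Some A)
| Lbot : STLN [:: Bot] None
| Rtop : STLN [::] (Some Top)
| Lw G A D : STLN G D -> STLN (A :: G) D
| Rw G A : STLN G None -> STLN G (Some A)
| Lc G A D : STLN (A :: A :: G) D -> STLN (A :: G) D
| Cut G S A D : STLN G (Some A) -> STLN (A :: S) D -> STLN (S ++ G) D
| Land1 G A B D : STLN (A :: G) D -> STLN (And A B :: G) D
| Land2 G A B D : STLN (B :: G) D -> STLN (And A B :: G) D
| Rand G A B : STLN G (Some A) -> STLN G (Some B) -> STLN G (Some (And A B))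
| Lor G A B D : STLN (A :: G) D -> STLN (B :: G) D -> STLN (Or A B :: G) D
| Ror1 G A B : STLN G (Some A) -> STLN G (Some (Or A B))
| Ror2 G A B : STLN G (Some B) -> STLN G (Some (Or A B))
| RuleN G D : STLN G D -> STLN (map (@Nabla V) G) (omap (@Nabla V) D)
| Limp G A B D :
    STLN G (Some A) -> STLN (B :: G) D -> STLN (Nabla (Imp A B) :: G) D
| Rimp G A B :
    STLN (A :: map (@Nabla V) G) (Some B) -> STLN G (Some (Imp A B)).

Definition iKdstar (V : Type) (A : form V) : Prop := STLN [::] (Some A).

(* Main.v *)
Require Import Defs.
From mathcomp Require Import all_boot.
From Stdlib Require List Permutation.

(** A Kleene-style slash argument, carried out without cut elimination.

    Semantically, [Nabla] looks along a monotone map [pi] of a Kripke frame: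
    a point [x] forces [Nabla A] when [pi x] forces [A], and [x] forces
    [Imp A B] when every [y] with [x <= pi y] that forces [A] forces [B].
    Let [T] be the theory of the sequents [X => F].  The point reached
    from [T] by [n] applications of [pi] is the theory of all [F] with
    [Nabla^n F] in [T].  These theories need not be prime, so, as in the glueing
    of a Freyd cover, truth at stage [n] is defined by recursion on formulas
    ([forces]) and at the same time kept below membership: atoms and implications
    forced at stage [n] are required to belong to the [n]-th theory, and
    so everything forced does ([forces_theory]).  Stages are ordered discretely
    and [pi] sends [n] to [n.+1], hence an implication at stage [n.+1] has to
    be tested at stage [n] only, and at stage [0] nowhere.

    Every derivable sequent is valid at every stage ([forces_sound]).  If [X]
    is forced at stage [0], then so is [Or C D], hence so is [C] or [D], and being
    forced at stage [0] entails being derivable from [X].  Now a conjunct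
    [Nabla^(m i) (A i -> B i)] of [X] is forced at stage [0] as soon as
    [A i] being forced at stage [m i - 1] entails the same for [B i].  If that fails,
    [A i] is forced at stage [m i - 1], so [X] derives [Nabla^(m i - 1) (A i)],
    which is the first alternative of the rule.

    This last case distinction is made constructive by letting forcing carry
    an escape proposition [P], here the first alternative itself: the
    implication clause and soundness only promise [P] or the forcing of
    their conclusion. *)

Definition theory {V : Type} (T : form V -> Prop) : Prop :=
  forall G E, STLN G (Some E) -> List.Forall T G -> T E.

Fixpoint forces {V : Type} (T : form V -> Prop) (P : Prop)
    (F : form V) (n : nat) : Prop :=
  match F with
  | Atom _ => T (iter n (@Nabla V) F)
  | Top => True
  | Bot => False
  | And A B => forces T P A n /\ forces T P B n
  | Or A B => forces T P A n \/ forces T P B n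
  | Imp A B =>
      T (iter n (@Nabla V) F) /\
      (if n is k.+1 then forces T P A k -> P \/ forces T P B k else True)
  | Nabla A => forces T P A n.+1
  end.

Lemma STLN_iterN {V : Type} n (G : seq (form V)) (D : option (form V)) :
  STLN G D ->
  STLN (map (iter n (@Nabla V)) G) (omap (iter n (@Nabla V)) D).
Proof.
move=> GD; elim: n => [|n IHn].
  by rewrite (eq_map (g := id)) // map_id; case: D GD.
have := RuleN IHn; rewrite -map_comp.
by case: D {GD IHn}.
Qed.

Lemma Forall_map_seq {S R : Type} (f : S -> R) (Q : R -> Prop) (s : seq S) :
  List.Forall Q (map f s) <-> List.Forall (fun x => Q (f x)) s.
Proof.
elim: s => [|x s IHs] /=; first by split.
by rewrite !List.Forall_cons_iff IHs.
Qed.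

Lemma theory_iterN {V : Type} n {T : form V -> Prop} {G E} :
  theory T -> STLN G (Some E) ->
  List.Forall (fun F => T (iter n (@Nabla V) F)) G -> T (iter n (@Nabla V) E).
Proof.
move=> thT /(STLN_iterN n) GE TG.
exact: thT GE (proj2 (Forall_map_seq _ _ _) TG).
Qed.

Lemma STLN_theory {V : Type} (X : form V) :
  theory (fun F => STLN [:: X] (Some F)).
Proof.
move=> G E GE XG.
suff: STLN (X :: G) (Some E) -> STLN [:: X] (Some E) by apply; apply: Lw.
elim: XG {GE} => [//|F {}G XF _ IH] XFG; apply: IH; apply: Lc.
have FXG : STLN (F :: X :: G) (Some E).
  by apply: Exch XFG; apply: Permutation.perm_swap.
apply: (Exch _ (Cut XF FXG)).
apply: Permutation.Permutation_sym.
exact: (Permutation.Permutation_cons_append (X :: G)).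
Qed.

(** This turns the forced disjunct of a forced disjunction into a
    derivable one, although [T] itself need not split disjunctions.  The
    clauses of [forces] for atoms and implications mention [T] for its sake. *)
Lemma forces_theory {V : Type} {T : form V -> Prop} {P : Prop} :
  theory T -> forall {F n}, forces T P F n -> T (iter n (@Nabla V) F).
Proof.
move=> thT; elim=> [p||| A IHA B IHB| A IHA B IHB| A _ B _| A IHA] n //=.
- by move=> _; apply: (theory_iterN n thT (Rtop V)).
- case=> /IHA TA /IHB TB.
  apply: (theory_iterN n thT (G := [:: A; B])); last by do !constructor.
  apply: Rand; last by apply/Lw/Id.
  by apply: Exch (Lw B (Id A)); apply: Permutation.perm_swap.
- case=> [/IHA|/IHB] TF.
  + by apply: (theory_iterN n thT (Ror1 B (Id A))); do !constructor.
  + by apply: (theory_iterN n thT (Ror2 A (Id B))); do !constructor.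
- by case.
- by move/IHA; rewrite iterSr.
Qed.

(** Only right implication involves [T]: its premises being forced at stage [n],
    they lie in the [n]-th theory, which therefore contains the implication.
    The premise of that rule is then used one stage below. *)
Lemma forces_sound {V : Type} {T : form V -> Prop} {P : Prop} :
  theory T -> forall {G D}, STLN G D ->
  forall n, List.Forall (fun F => forces T P F n) G ->
  P \/ (if D is Some E then forces T P E n else False).
Proof.
move=> thT G D; elim=> {G D}.
- move=> G G' D /Permutation.Permutation_sym GG' _ IH n Gn.
  by apply: IH; apply: Permutation.Permutation_Forall Gn.
- by move=> A n /List.Forall_cons_iff[An _]; right.
- by move=> n /List.Forall_cons_iff[].
- by right.
- by move=> G A D _ IH n /List.Forall_cons_iff[_ /IH].
- by move=> G A _ IH n /IH[]; [left|].
- move=> G A D _ IH n /List.Forall_cons_iff[An Gn].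
  by apply: IH; do !constructor.
- move=> G S A D _ IHG _ IHS n /List.Forall_app[Sn /IHG[Pn|An]]; first by left.
  by apply: IHS; constructor.
- move=> G A B D _ IH n /List.Forall_cons_iff[[An _] Gn].
  by apply: IH; constructor.
- move=> G A B D _ IH n /List.Forall_cons_iff[[_ Bn] Gn].
  by apply: IH; constructor.
- move=> G A B _ IHA _ IHB n Gn.
  have [|An] := IHA n Gn; first by left.
  by have [|Bn] := IHB n Gn; [left | right].
- move=> G A B D _ IHA _ IHB n /List.Forall_cons_iff[[An|Bn] Gn].
  + by apply: IHA; constructor.
  + by apply: IHB; constructor.
- by move=> G A B _ IH n /IH[|An]; [left | right; left].
- by move=> G A B _ IH n /IH[|Bn]; [left | right; right].
- move=> G D _ IH n /Forall_map_seq Gn.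
  by have := IH n.+1 Gn; case: D {IH}.
- move=> G A B D _ IHA _ IHB n /List.Forall_cons_iff[[_ AB] Gn].
  have [|An] := IHA n Gn; first by left.
  have [|Bn] := AB An; first by left.
  by apply: IHB; constructor.
- move=> G A B GAB IH n Gn; right; split.
    apply: (theory_iterN n thT (Rimp GAB)).
    by apply: List.Forall_impl Gn => F; apply: forces_theory.
  case: n Gn => [//|n] Gn An; apply: IH; constructor => //.
  exact/Forall_map_seq.
Qed.

Lemma forces_iterN {V : Type} (T : form V -> Prop) (P : Prop) F k n :
  forces T P F (k + n) -> forces T P (iter k (@Nabla V) F) n.
Proof. by elim: k n => //= k IHk n; rewrite addSnnS; apply: IHk. Qed.

Lemma forces_bigAnd {V : Type} {J : Type} (T : form V -> Prop) (P : Prop) n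
    (f : J -> form V) (s : seq J) :
  (forall i, forces T P (f i) n) -> forces T P (bigAnd (map f s)) n.
Proof. by move=> fn; elim: s => [//|i [|j s] IHs]; [apply: fn | split]. Qed.

Lemma STLN_bigAnd {V : Type} {J : eqType} (f : J -> form V) {s : seq J} i :
  i \in s -> STLN [:: bigAnd (map f s)] (Some (f i)).
Proof.
elim: s => [//|j [|k s] IHs]; first by rewrite inE => /eqP->; apply: Id.
rewrite inE => /orP[/eqP-> | /IHs i_s]; first exact/Land1/Id.
exact: Land2.
Qed.

(** Right implication is invertible on an empty context: left implication
    acts on [Nabla (Imp A B)] only, but [RuleN] adds the [Nabla] to a theorem. *)
Lemma iKdstar_Imp {V : Type} (A B : form V) :
  iKdstar (Imp A B) <-> STLN [:: A] (Some B).
Proof.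
split=> [AB|]; last exact: (@Rimp V [::]).
apply: (@Cut V [::] [:: A] _ _ (RuleN AB)); apply: Limp; first exact: Id.
by apply: (Exch (Permutation.perm_swap _ _ _)); apply/Lw/Id.
Qed.

Theorem theorem13 (V : Type) (I : finType) (m : I -> nat)
    (A B : I -> form V) (C D : form V) :
  let X := bigAnd [seq iter (m i) (@Nabla V) (Imp (A i) (B i)) | i <- enum I] in
  iKdstar (Imp X (Or C D)) ->
  (exists i : I, 1 <= m i /\ iKdstar (Imp X (iter (m i - 1) (@Nabla V) (A i))))
  \/ iKdstar (Imp X C)
  \/ iKdstar (Imp X D).
Proof.
move=> X /iKdstar_Imp XCD; set P := (P in P \/ _).
pose T F := STLN [:: X] (Some F).
have thT : theory T := STLN_theory X.
have X0 : forces T P X 0.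
  apply: forces_bigAnd => i; apply: forces_iterN; rewrite addn0.
  split; first by apply: (STLN_bigAnd _ i); rewrite mem_enum.
  case mi: (m i) => [//|k] Ak; left; exists i; rewrite mi subn1; split=> //.
  exact/iKdstar_Imp/(forces_theory thT Ak).
have X0s : List.Forall (fun F => forces T P F 0) [:: X] by constructor.
have [|[C0|D0]] := forces_sound thT XCD 0 X0s.
- by left.
- by right; left; apply/iKdstar_Imp/(forces_theory thT C0).
- by right; right; apply/iKdstar_Imp/(forces_theory thT D0).
Qed.
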